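(* Let $n,k$ be two positive integers with $k\geq 2$ and $n\geq 2(k-1)$, let $G_{n,k}$ be the graph on $n$ vertices defined in the context, and let $\boldsymbol{x}$ be the Perron vector of $G_{n,k}$, with $x_u$ its component at the vertex $u$. Then there exists an independent set $S$ in $G_{n,k}$ such that $$\sum_{u\in S} x_u^2 = \frac{1}{2} - O\Big(\frac{k^5}{n^3}\Big),$$ where the constant implied by $O(\cdot)$ is absolute (independent of $n$ and $k$).
   Context: For a connected graph $G$, the Perron vector of $G$ is the unique positive unit-length (Euclidean norm) eigenvector of the adjacency matrix $A(G)$ corresponding to its largest eigenvalue. Definition of $G_{n,k}$: write $n = (k-1)t + s$ with integers $t$ and $0\leq s<k-1$. The vertex set of $G_{n,k}$ is partitioned into $t+1$ sets $V_0,V_1,\ldots,V_t$ with $|V_0|=\cdots=|V_{t-1}|=k-1$ and $|V_t|=s$ (so $V_t$ may be empty). The edge set is $$E(G_{n,k}) = \{uv: u\in V_i,\ v\in V_{i+1},\ i=0,1,\ldots,t-1\}\cup\{uv: u,v\in V_0,\ u\neq v\}.$$ That is, $V_0$ induces a clique, each of $V_1,\ldots,V_t$ is an independent set, consecutive sets $V_i,V_{i+1}$ are completely joined, and there are no other edges. The graph $G_{n,k}$ is connected and has chromatic number $k$. *)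

(* Defs.v *)
From HB Require Import structures.
From mathcomp Require Import all_boot all_order all_algebra.
From mathcomp Require Import reals.
Set Implicit Arguments.
Unset Strict Implicit.
Unset Printing Implicit Defensive.
Import Order.TTheory GRing.Theory Num.Theory.
Local Open Scope ring_scope.

(* Graphs are boolean relations on a finite vertex type. *)

Definition independent (T : finType) (e : rel T) (S : {set T}) : bool :=
  [forall u in S, forall v in S, ~~ e u v].

Definition adjacency (R : nzRingType) (n : nat) (e : rel 'I_n) : 'M[R]_n :=
  \matrix_(u, v) (e u v)%:R.

Definition largest_eigenvalue (R : realType) (n : nat) (A : 'M[R]_n) (a : R) :
    Prop :=
  eigenvalue A a /\ forall b, eigenvalue A b -> b <= a.

Definition euclidean_norm (R : realType) (n : nat) (x : 'rV[R]_n) : R :=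
  Num.sqrt (\sum_(u < n) x 0 u ^+ 2).

(* Row vectors, because MathComp's [eigenvalue] and [eigenspace] act on the
   left; the adjacency matrix of an undirected graph is symmetric. *)
Definition perron_vector (R : realType) (n : nat) (e : rel 'I_n)
    (x : 'rV[R]_n) : Prop :=
  exists a : R,
    [/\ largest_eigenvalue (adjacency R e) a,
        x *m adjacency R e = a *: x,
        forall u, 0 < x 0 u
      & euclidean_norm x = 1].

(* Write n = (k - 1) t + s with s < k - 1, so t = n %/ k.-1 and s = n %% k.-1.
   The vertices 0, ..., n - 1 are cut into consecutive blocks of length k - 1,
   the last one, V_t, having the remaining s vertices; see [card_Gpart] and
   [card_Gpart_last]. *)
Definition Gpart (n k i : nat) : {set 'I_n} := [set u : 'I_n | u %/ k.-1 == i]%N.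

Definition Gnk (n k : nat) : rel 'I_n := fun u v =>
  [exists i : 'I_(n %/ k.-1),
     (u \in Gpart n k i) && (v \in Gpart n k i.+1)
     || (v \in Gpart n k i) && (u \in Gpart n k i.+1)]
  || [&& u \in Gpart n k 0, v \in Gpart n k 0 & u != v].

Lemma card_Gpart_block (n k i m : nat) :
  (i * k.-1 + m <= n)%N ->
  (forall u, (u < n)%N -> (u %/ k.-1 == i)%N = (i * k.-1 <= u < i * k.-1 + m)%N) ->
  #|Gpart n k i| = m.
Proof.
move=> le_n Hu.
pose f (j : 'I_m) : 'I_n :=
  Ordinal (leq_trans (eq_leq (esym (addnS (i * k.-1) j)))
            (leq_trans (leq_add (leqnn (i * k.-1)) (ltn_ord j)) le_n)).
have f_inj : injective f.
  by move=> j1 j2 /(congr1 val) /= /addnI /val_inj.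
rewrite -[RHS](card_ord m) -cardsT -(card_imset _ f_inj).
apply: eq_card => u; rewrite inE Hu //; apply/andP/imsetP => [[le_u lt_u]|[j _ ->]].
  have lt_m : (u - i * k.-1 < m)%N by rewrite ltn_subLR.
  by exists (Ordinal lt_m); rewrite ?inE //; apply/val_inj; rewrite /= subnKC.
by rewrite /= leq_addr ltn_add2l ltn_ord.
Qed.

Lemma card_Gpart (n k i : nat) :
  (1 < k)%N -> (i < n %/ k.-1)%N -> #|Gpart n k i| = k.-1.
Proof.
case: k => [|[|k]] //= _ lt_i; apply: card_Gpart_block => [|u lt_u] /=.
  by rewrite -mulSnr; apply: leq_trans (leq_divM n k.+1); rewrite leq_mul2r lt_i orbT.
by rewrite -mulSnr eqn_leq andbC leq_divRL // -(ltnS (u %/ _)) ltn_divLR.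
Qed.

Lemma card_Gpart_last (n k : nat) :
  (1 < k)%N -> #|Gpart n k (n %/ k.-1)| = (n %% k.-1)%N.
Proof.
case: k => [|[|k]] //= _; apply: card_Gpart_block => [|u lt_u] /=.
  by rewrite -divn_eq.
by rewrite -divn_eq lt_u andbT -leq_divRL // eqn_leq (leq_div2r _ (ltnW lt_u)).
Qed.

Lemma Gnk_sym (n k : nat) : symmetric (@Gnk n k).
Proof.
move=> u v; rewrite /Gnk eq_sym; congr (_ || _).
  by apply: eq_existsb => i; rewrite orbC.
by rewrite andbCA.
Qed.

Lemma Gnk_irr (n k : nat) : irreflexive (@Gnk n k).
Proof.
move=> u; rewrite /Gnk eqxx !andbF orbF; apply/existsP => -[i].
by rewrite orbb !inE => /andP[/eqP-> /eqP /n_Sn].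
Qed.

(* Main.v *)
(* Take S to be the union of the odd levels V_1, V_3, ... and put m = k - 1.
   With a the Perron eigenvalue, pairing A x with x signed by the parity of the
   level cancels every edge except those of the clique V_0, so a (1 - 2 sum_S
   x^2) lies between 0 and P^2, where P is the sum of x over V_0.  Every vertex
   has degree at most 2m, and those of V_0 have degree 2m - 1, so testing A x =
   a x against the all-ones vector gives P <= (2m - a) sum x <= (2m - a) sqrt n.
   Finally 2m - a <= 10 m / t^2 by the Rayleigh quotient of the vector i (t - i)
   on V_i, while a >= m is the minimum degree; since n <= 2 m t, the defect is
   O(m^5 / n^3). *)

Require Import Defs.
From HB Require Import structures.
From mathcomp Require Import all_boot all_order all_algebra.
From mathcomp Require Import reals.
From mathcomp Require Import ring lra zify.
Set Implicit Arguments.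
Unset Strict Implicit.
Unset Printing Implicit Defensive.
Import Order.TTheory GRing.Theory Num.Theory.
Local Open Scope ring_scope.

(** * Real inequalities and polynomial sums *)

(* Summing A u v x_u x_v (f_u / x_u - f_v / x_v)^2 >= 0 over u, v avoids any
   spectral theorem. *)
Lemma rayleigh_le_positive_eigenvalue (R : realFieldType) (I : finType)
    (A : I -> I -> R) (x f : I -> R) (a : R) :
  (forall u v, 0 <= A u v) -> (forall u v, A u v = A v u) ->
  (forall u, 0 < x u) -> (forall u, \sum_v A u v * x v = a * x u) ->
  \sum_u f u * (\sum_v A u v * f v) <= a * \sum_u f u ^+ 2.
Proof.
move=> A0 Asym x0 eig.
have x_neq0 u : x u != 0 by rewrite gt_eqF.
have a_sum : a * \sum_u f u ^+ 2
    = \sum_u \sum_v A u v * (x v / x u * f u ^+ 2).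
  rewrite mulr_sumr; apply: eq_bigr => u _.
  rewrite -[a in LHS](mulfK (x_neq0 u)) -eig !mulr_suml.
  by apply: eq_bigr => v _; rewrite !mulrA.
have a_sum' : a * \sum_u f u ^+ 2
    = \sum_u \sum_v A u v * (x u / x v * f v ^+ 2).
  rewrite a_sum exchange_big; apply: eq_bigr => u _.
  by apply: eq_bigr => v _; rewrite Asym.
suff : 0 <= a * (\sum_u f u ^+ 2) + a * (\sum_u f u ^+ 2)
    - 2 * \sum_u f u * (\sum_v A u v * f v) by lra.
rewrite {1}a_sum a_sum' mulr_sumr -big_split -sumrB /=.
apply: sumr_ge0 => u _; rewrite !mulr_sumr -big_split -sumrB /=.
apply: sumr_ge0 => v _.
have -> : A u v * (x v / x u * f u ^+ 2) + A u v * (x u / x v * f v ^+ 2)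
    - 2 * (f u * (A u v * f v))
    = A u v * (x u * x v) * (f u / x u - f v / x v) ^+ 2.
  by field; rewrite !x_neq0.
by rewrite mulr_ge0 ?sqr_ge0 // mulr_ge0 // mulr_ge0 // ltW.
Qed.

(** Cauchy-Schwarz with the all-ones vector, read off from the nonnegative sum of squared deviations
    from the mean. *)
Lemma sqr_sum_le_card (R : realFieldType) (n : nat) (x : 'I_n -> R) :
  (0 < n)%N -> (\sum_u x u) ^+ 2 <= n%:R * \sum_u x u ^+ 2.
Proof.
move=> n0; set s := \sum_u x u.
have n0' : 0 < n%:R :> R by rewrite ltr0n.
have : 0 <= \sum_u (x u - s / n%:R) ^+ 2 by apply: sumr_ge0 => u _; rewrite sqr_ge0.
have -> : \sum_u (x u - s / n%:R) ^+ 2 = \sum_u x u ^+ 2 - s ^+ 2 / n%:R.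
  under eq_bigr => u _ do rewrite sqrrB.
  rewrite big_split sumrB /= sumr_const card_ord sumrMnl -mulr_suml -/s.
  rewrite -[_ *+ n]mulr_natr -mulr_natr; field; by rewrite gt_eqF.
by rewrite subr_ge0 ler_pdivrMr // mulrC.
Qed.

(** This sum and the next evaluate the Rayleigh inequality for the test vector i (t - i). *)
Lemma sum_parabola (R : realFieldType) (t : nat) :
  \sum_(i < t) (i%:R * (t%:R - i%:R)) = t%:R * (t%:R ^+ 2 - 1) / 6 :> R.
Proof.
(* [c] stays fixed while the number of terms grows; with [t] in both places an induction would
   change every summand. *)
have gen (c : R) N : \sum_(i < N) (i%:R * (c - i%:R))
    = c * (N%:R * (N%:R - 1) / 2) - N%:R * (N%:R - 1) * (2 * N%:R - 1) / 6.
  elim: N => [|N IH]; first by rewrite big_ord0; field.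
  by rewrite big_ord_recr /= IH -natr1; field.
by rewrite gen; field.
Qed.

Lemma sum_sqr_parabola (R : realFieldType) (t : nat) :
  \sum_(i < t) (i%:R * (t%:R - i%:R)) ^+ 2
    = t%:R * (t%:R ^+ 2 - 1) * (t%:R ^+ 2 + 1) / 30 :> R.
Proof.
have gen (c : R) N : \sum_(i < N) (i%:R * (c - i%:R)) ^+ 2
    = c ^+ 2 * (N%:R * (N%:R - 1) * (2 * N%:R - 1) / 6)
      - c * (N%:R ^+ 2 * (N%:R - 1) ^+ 2 / 2)
      + N%:R * (N%:R - 1) * (2 * N%:R - 1)
        * (3 * N%:R ^+ 2 - 3 * N%:R - 1) / 30.
  elim: N => [|N IH]; first by rewrite big_ord0; field.
  by rewrite big_ord_recr /= IH -natr1; field.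
by rewrite gen; field.
Qed.

(** * Adjacency, level sums and degrees in [Gnk] *)

Lemma GnkE (n k : nat) (u v : 'I_n) :
  Gnk k u v = [|| v %/ k.-1 == (u %/ k.-1).+1, u %/ k.-1 == (v %/ k.-1).+1
              | [&& u %/ k.-1 == 0, v %/ k.-1 == 0 & u != v]]%N.
Proof.
have lvl (w : 'I_n) : (w %/ k.-1 <= n %/ k.-1)%N by rewrite leq_div2r // ltnW.
rewrite /Gnk orbA !inE; congr (_ || _).
apply/existsP/idP => [[i]|].
  rewrite !inE => /orP[]/andP[/eqP-> /eqP->]; rewrite eqxx ?orbT //.
case/orP => /eqP E.
  have Hi : (u %/ k.-1 < n %/ k.-1)%N by rewrite -E lvl.
  by exists (Ordinal Hi); rewrite !inE /= E !eqxx.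
have Hi : (v %/ k.-1 < n %/ k.-1)%N by rewrite -E lvl.
by exists (Ordinal Hi); rewrite !inE /= E !eqxx orbT.
Qed.

Lemma card_Gpart_le (n k i : nat) : (1 < k)%N -> (#|Gpart n k i| <= k.-1)%N.
Proof.
move=> k1; have k0 : (0 < k.-1)%N by case: k k1 => [|[]].
case: (ltngtP i (n %/ k.-1)) => [lt_i|gt_i|->].
- by rewrite card_Gpart.
- rewrite (_ : Gpart n k i = set0) ?cards0 //; apply/setP => u; rewrite !inE.
  apply/negbTE; rewrite neq_ltn; apply/orP; left.
  by apply: leq_ltn_trans gt_i; rewrite leq_div2r // ltnW.
- by rewrite card_Gpart_last // ltnW // ltn_mod.
Qed.

Lemma sum_Gpart_level (R : pzRingType) (n k i : nat) (F : nat -> R) :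
  \sum_(v in Gpart n k i) F (v %/ k.-1)%N = #|Gpart n k i|%:R * F i.
Proof.
rewrite (eq_bigr (fun=> F i)); last by move=> v; rewrite inE => /eqP->.
by rewrite sumr_const mulr_natl.
Qed.

(** [F] vanishes on the last block, the only one whose size differs from [k.-1]. *)
Lemma sum_level (R : pzRingType) (n k : nat) (F : nat -> R) :
  (1 < k)%N -> F (n %/ k.-1)%N = 0 ->
  \sum_(u < n) F (u %/ k.-1)%N = k.-1%:R * \sum_(i < n %/ k.-1) F i.
Proof.
move=> k1 Ft.
have lvl (w : 'I_n) : (w %/ k.-1 < (n %/ k.-1).+1)%N by rewrite ltnS leq_div2r // ltnW.
rewrite (partition_big (fun u => Ordinal (lvl u)) predT) //= big_ord_recr /=.
have part (i : 'I_(n %/ k.-1).+1) :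
    \sum_(u < n | Ordinal (lvl u) == i) F (u %/ k.-1)%N = #|Gpart n k i|%:R * F i.
  by rewrite -sum_Gpart_level; apply: eq_bigl => u; rewrite inE -val_eqE.
rewrite part /= Ft mulr0 addr0 mulr_sumr; apply: eq_bigr => i _.
by rewrite part /= card_Gpart ?ltn_ord.
Qed.

(** Outside V_0 the clique contributes nothing. For [u] in the last level the block [i.+2] is empty,
    so one formula covers that case too. *)
Lemma sum_Gnk_succ (R : pzRingType) (n k i : nat) (u : 'I_n) (F : nat -> R) :
  (u %/ k.-1 = i.+1)%N ->
  \sum_v (Gnk k u v)%:R * F (v %/ k.-1)%N
    = #|Gpart n k i|%:R * F i + #|Gpart n k i.+2|%:R * F i.+2.
Proof.
move=> ui; rewrite -!sum_Gpart_level ![\sum_(v in _) _]big_mkcond -big_split /=.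
apply: eq_bigr => v _; rewrite GnkE ui !inE /= orbF eqSS eq_sym.
have [->|] := eqVneq i (v %/ k.-1)%N.
  by rewrite orbT gtn_eqF ?leqnSn // mul1r addr0.
by move=> _; rewrite orbF; case: (i.+2 == _); rewrite ?mul1r ?mul0r add0r.
Qed.

(** The subtracted 1 is the missing loop at [u]; it is moved across so that the term [v = u]
    balances it. *)
Lemma degree_Gnk_0 (R : pzRingType) (n k : nat) (u : 'I_n) :
  (u %/ k.-1 = 0)%N ->
  \sum_v (Gnk k u v)%:R = #|Gpart n k 0|%:R + #|Gpart n k 1|%:R - 1 :> R.
Proof.
move=> u0; apply/(canRL (addrK 1)).
rewrite -!sumr_const ![\sum_(v in _) _]big_mkcond -big_split /=.
rewrite (bigD1 u) // [RHS](bigD1 u) //= Gnk_irr add0r addrC !inE u0 /= addr0.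
congr (_ + _); apply: eq_bigr => v vu; rewrite GnkE u0 !inE (eq_sym u) vu andbT /=.
by case: (v %/ k.-1)%N => [|[|j]]; rewrite ?addr0 ?add0r.
Qed.

(** With t >= 2 both V_0 and V_1 are full; at any later level the preceding block is full. The drop
    by 1 on V_0 is what later bounds the sum of x over the clique. *)
Lemma degree_Gnk_bounds (R : numDomainType) (n k : nat) (u : 'I_n) :
  (1 < k)%N -> (2 <= n %/ k.-1)%N ->
  (k.-1%:R <= \sum_v (Gnk k u v)%:R :> R)
  && (\sum_v (Gnk k u v)%:R <= 2 * k.-1%:R - (u %/ k.-1 == 0)%N%:R :> R).
Proof.
move=> k1 t2; have k0 : (0 < k.-1)%N by case: k k1 {t2} => [|[]].
case ui : (u %/ k.-1)%N => [|i].
  rewrite degree_Gnk_0 // !card_Gpart // 1?ltnW // mulr_natl mulr2n lexx andbT.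
  by rewrite -addrA lerDl subr_ge0 ler1n.
have := sum_Gnk_succ (fun=> 1 : R) ui; under eq_bigr do rewrite mulr1.
move=> ->; rewrite !mulr1 subr0 card_Gpart //; last first.
  by rewrite -ui leq_div2r // ltnW.
by rewrite lerDl ler0n mulr_natl mulr2n lerD2l ler_nat card_Gpart_le.
Qed.

Lemma Gnk_parity (n k : nat) (u v : 'I_n) :
  Gnk k u v -> (u %/ k.-1 == 0)%N && (v %/ k.-1 == 0)%N
    \/ odd (v %/ k.-1) = ~~ odd (u %/ k.-1).
Proof.
rewrite GnkE => /or3P[/eqP->|/eqP->|/and3P[-> -> _]]; [right|right|left] => //.
by rewrite /= negbK.
Qed.

Lemma independent_odd_levels (n k : nat) :
  independent (@Gnk n k) [set u : 'I_n | odd (u %/ k.-1)].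
Proof.
apply/forall_inP => u; rewrite inE => ou; apply/forall_inP => v; rewrite inE => ov.
apply/negP => /Gnk_parity[/andP[/eqP u0 _]|]; first by rewrite u0 in ou.
by rewrite ou ov.
Qed.

(** * Spectral bounds for a positive unit eigenvector *)

Section PerronVector.

Variables (R : realType) (n k : nat) (x : 'I_n -> R) (a : R).

Local Notation m := (k.-1%:R : R).
Local Notation t := ((n %/ k.-1)%N%:R : R).

Hypothesis k_gt1 : (1 < k)%N.
Hypothesis t_ge2 : (2 <= n %/ k.-1)%N.
Hypothesis x_gt0 : forall u, 0 < x u.
Hypothesis x_norm : \sum_u x u ^+ 2 = 1.
Hypothesis x_eig : forall u, \sum_v (Gnk k u v)%:R * x v = a * x u.

Let m_ge1 : 1 <= m.
Proof. by rewrite ler1n; case: k k_gt1 => [|[]]. Qed.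

Let t_ge2R : 2 <= t.
Proof. by rewrite ler_nat. Qed.

Let n_gt0 : (0 < n)%N.
Proof. by apply: leq_trans (leq_div n k.-1); apply: ltnW. Qed.

Let sum_x_gt0 : 0 < \sum_u x u.
Proof.
rewrite (bigD1 (Ordinal n_gt0)) //=; apply: ltr_wpDr => //.
by apply: sumr_ge0 => u _; rewrite ltW.
Qed.

(** Pairs A x = a x with the all-ones vector, using the symmetry of A. *)
Let sum_degree : \sum_u (\sum_v (Gnk k u v)%:R) * x u = a * \sum_u x u.
Proof.
under eq_bigr => u _ do rewrite mulr_suml.
rewrite exchange_big mulr_sumr; apply: eq_bigr => v _; rewrite -x_eig.
by apply: eq_bigr => u _; rewrite Gnk_sym.
Qed.

Lemma Gnk_eigenvalue_ge : m <= a.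
Proof.
rewrite -(ler_pM2r sum_x_gt0) -sum_degree mulr_sumr; apply: ler_sum => u _.
apply: ler_wpM2r; first exact: ltW.
by case/andP: (degree_Gnk_bounds R u k_gt1 t_ge2).
Qed.

(** The weight 2m - deg u is at least 1 on V_0 and at least 0 elsewhere. *)
Lemma Gnk_sum_clique_le :
  \sum_(u in Gpart n k 0) x u <= (2 * m - a) * \sum_u x u.
Proof.
rewrite mulrBl -sum_degree mulr_sumr -sumrB big_mkcond /=; apply: ler_sum => u _.
have /andP[_] := degree_Gnk_bounds R u k_gt1 t_ge2; rewrite inE.
by have := x_gt0 u; case: eqP => _ /=; nra.
Qed.

(* Rayleigh quotient of the test vector [i (t - i)], which vanishes on the
   irregular ends [V_0] and [V_t]. *)
Lemma Gnk_eigenvalue_gap : (2 * m - a) * (t ^+ 2 + 1) <= 10 * m.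
Proof.
pose g i : R := i%:R * (t - i%:R).
have gt : g (n %/ k.-1)%N = 0 by rewrite /g subrr mulr0.
(* The second difference of i (t - i) is -2, so A g = 2 m (g - 1) wherever g is nonzero. *)
have row (u : 'I_n) : g (u %/ k.-1)%N * (\sum_v (Gnk k u v)%:R * g (v %/ k.-1)%N)
    = 2 * m * g (u %/ k.-1)%N ^+ 2 - 2 * m * g (u %/ k.-1)%N.
  case ui : (u %/ k.-1)%N => [|i]; first by rewrite /g; ring.
  have : (i.+1 <= n %/ k.-1)%N by rewrite -ui leq_div2r // ltnW.
  rewrite leq_eqVlt => /orP[/eqP->|it]; first by rewrite gt; ring.
  have -> : \sum_v (Gnk k u v)%:R * g (v %/ k.-1)%N = m * g i + m * g i.+2.
    rewrite (sum_Gnk_succ _ ui) card_Gpart // 1?ltnW //.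
    (* V_t has fewer than m vertices, which is harmless since [g] vanishes there. *)
    move: it; rewrite leq_eqVlt => /orP[/eqP->|it]; first by rewrite gt !mulr0.
    by rewrite card_Gpart.
  by rewrite /g -!natr1; ring.
have := @rayleigh_le_positive_eigenvalue R _ (fun u v => (Gnk k u v)%:R) x
  (fun u => g (u %/ k.-1)%N) a (fun u v => ler0n R _)
  (fun u v => congr1 (fun b : bool => b%:R) (Gnk_sym _ u v)) x_gt0 x_eig.
rewrite (eq_bigr _ (fun u _ => row u)) sumrB -!mulr_sumr.
rewrite (sum_level k_gt1 gt) (@sum_level _ _ _ (fun i => g i ^+ 2)) //; last first.
  by rewrite gt expr0n.
rewrite sum_parabola sum_sqr_parabola => le.
(* The factor m t (t^2 - 1), common to both level sums, cancels; 10 is 2 * 30 / 6. *)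
have q : 0 < m * (t * (t ^+ 2 - 1)) 
  by rewrite !mulr_gt0 // ?subr_gt0 ?exprn_egt1 //; move: m_ge1 t_ge2R; lra.
rewrite -(ler_pM2l q) -subr_ge0; rewrite -subr_ge0 in le.
move: le; lra.
Qed.

Let signed (u : 'I_n) : R := (-1) ^+ odd (u %/ k.-1).

(* Edges between consecutive levels cancel in the signed sum of [x_u (A x)_u];
   only the clique on [V_0] survives. *)
Lemma Gnk_signed_norm :
  a * \sum_u signed u * x u ^+ 2
    = \sum_(u in Gpart n k 0) \sum_(v in Gpart n k 0 | v != u) x u * x v.
Proof.
set lhs := LHS.
have E1 : lhs = \sum_u \sum_v (Gnk k u v)%:R * signed u * (x u * x v).
  rewrite /lhs mulr_sumr; apply: eq_bigr => u _.
  have -> : a * (signed u * x u ^+ 2) = signed u * x u * (a * x u) by ring.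
  by rewrite -x_eig mulr_sumr; apply: eq_bigr => v _; ring.
(* The same sum with the sign of [v]: adding both forms gives the weight [signed u + signed v],
   which is 0 or 2 on every edge. *)
have E2 : lhs = \sum_u \sum_v (Gnk k u v)%:R * signed v * (x u * x v).
  rewrite E1 exchange_big; apply: eq_bigr => u _; apply: eq_bigr => v _.
  by rewrite Gnk_sym (mulrC (x u)).
have : lhs + lhs = 2 * \sum_(u in Gpart n k 0) \sum_(v in Gpart n k 0 | v != u) x u * x v.
  rewrite {1}E1 E2 -big_split mulr_sumr [RHS]big_mkcond; apply: eq_bigr => u _ /=.
  rewrite -big_split.
  have -> : (if u \in Gpart n k 0 then
        2 * \sum_(v in Gpart n k 0 | v != u) x u * x v else 0)
      = \sum_v (if [&& u \in Gpart n k 0, v \in Gpart n k 0 & v != u]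
                then 2 * (x u * x v) else 0).
    case: (u \in _) => /=; last by rewrite big1.
    by rewrite mulr_sumr big_mkcond.
  apply: eq_bigr => v _ /=; rewrite /signed !inE.
  case e: (Gnk k u v); last first.
    rewrite ifN; first by rewrite !mul0r addr0.
    by apply: contraFN e => /and3P[u0 v0 vu]; rewrite GnkE u0 v0 (eq_sym u) vu !orbT.
  case: (Gnk_parity e) => [/andP[u0 v0]|odd_v].
    rewrite u0 v0 ifT; last by apply: contraTneq e => ->; rewrite Gnk_irr.
    by rewrite (eqP u0) (eqP v0) /=; ring.
  rewrite ifN; first by rewrite odd_v signrN; ring.
  by apply: contra_eqN odd_v => /and3P[/eqP-> /eqP-> _].
lra.
Qed.

Lemma Gnk_odd_norm_bound :
  `|1 / 2 - \sum_(u in [set u : 'I_n | odd (u %/ k.-1)]) x u ^+ 2|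
    <= 800 * (m ^+ 5 / n%:R ^+ 3).
Proof.
set s := \sum_(u in _) _.
set D := \sum_(u in Gpart n k 0) \sum_(v in Gpart n k 0 | v != u) x u * x v.
pose P := \sum_(u in Gpart n k 0) x u.
(* The signed norm is 1 - 2 s, since x has unit norm. *)
have aD : 2 * a * (1 / 2 - s) = D.
  rewrite -[D]Gnk_signed_norm -[X in X / 2]x_norm.
  have -> : \sum_u signed u * x u ^+ 2 = \sum_u x u ^+ 2 - 2 * s.
    rewrite /s [\sum_(u in _) _]big_mkcond mulr_sumr -sumrB; apply: eq_bigr => u _.
    by rewrite inE /signed; case: odd => /=; ring.
  by field.
have D_ge0 : 0 <= D.
  by do 2! (apply: sumr_ge0 => ? _); rewrite mulr_ge0 // ltW.
(* [D] is the expansion of P^2 without its diagonal. *)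
have D_le : D <= P ^+ 2.
  rewrite /P expr2 mulr_suml; apply: ler_sum => u _; rewrite mulr_sumr.
  rewrite [leRHS](bigID (fun v => v != u)) /= lerDl.
  by apply: sumr_ge0 => v _; rewrite mulr_ge0 // ltW.
have P_ge0 : 0 <= P by apply: sumr_ge0 => u _; rewrite ltW.
have n0 : 0 < n%:R :> R by rewrite ltr0n.
have m0 : 0 < m by apply: lt_le_trans m_ge1.
have t0 : 0 < t by apply: lt_le_trans t_ge2R.
have P_le : P ^+ 2 <= (10 * m / t ^+ 2) ^+ 2 * n%:R.
  have sum_le : (\sum_u x u) ^+ 2 <= n%:R.
    by have := sqr_sum_le_card x n_gt0; rewrite x_norm mulr1.
  (* The sign, needed to square the bounds, comes from 0 <= P <= (2m - a) sum x. *)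
  have gap_ge0 : 0 <= 2 * m - a.
    by rewrite -(pmulr_lge0 _ sum_x_gt0); apply: le_trans Gnk_sum_clique_le.
  have gap_le : 2 * m - a <= 10 * m / t ^+ 2.
    by rewrite ler_pdivlMr ?exprn_gt0 //; have := Gnk_eigenvalue_gap; nra.
  apply: (@le_trans _ _ (((2 * m - a) * \sum_u x u) ^+ 2)).
    by rewrite ler_sqr ?nnegrE ?Gnk_sum_clique_le // mulr_ge0 // ltW.
  rewrite exprMn ler_pM ?sqr_ge0 // ler_sqr ?nnegrE //.
  exact: le_trans gap_le.
have n_le : n%:R <= 2 * m * t.
  rewrite -!natrM ler_nat [leqLHS](divn_eq n k.-1).
  have : (n %% k.-1 < k.-1)%N by rewrite ltn_mod -(ltr_nat R).
  by move: t_ge2; nia.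
have a_ge := Gnk_eigenvalue_ge.
have s_ge0 : 0 <= 1 / 2 - s by nra.
rewrite ger0_norm //.
have : 2 * m * (1 / 2 - s) <= (10 * m / t ^+ 2) ^+ 2 * n%:R.
  by apply: le_trans P_le; apply: le_trans D_le; rewrite -aD; nra.
rewrite -ler_pdivlMl ?mulr_gt0 // => /le_trans; apply.
rewrite -subr_ge0.
(* The fourth power of n <= 2 m t gives 50 m n / t^4 <= 50 * 2^4 m^5 / n^3, whence 800. *)
have -> : 800 * (m ^+ 5 / n%:R ^+ 3) - (2 * m)^-1 * ((10 * m / t ^+ 2) ^+ 2 * n%:R)
    = 50 * m / (n%:R ^+ 3 * t ^+ 4) * ((2 * m * t) ^+ 4 - n%:R ^+ 4).
  by field; rewrite !gt_eqF.
apply: mulr_ge0; first by rewrite divr_ge0 ?mulr_ge0 ?exprn_ge0 ?ltW.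
by rewrite subr_ge0 lerXn2r // nnegrE ltW // !mulr_gt0.
Qed.

End PerronVector.

Theorem theorem5p1 (R : realType) :
  exists C : R, 0 < C /\
    forall (n k : nat), (2 <= k)%N -> (2 * (k - 1) <= n)%N ->
    forall x : 'rV[R]_n, perron_vector (@Gnk n k) x ->
    exists S : {set 'I_n},
      independent (@Gnk n k) S /\
      `| 1 / 2 - \sum_(u in S) x 0 u ^+ 2 | <= C * (k%:R ^+ 5 / n%:R ^+ 3).
Proof.
exists 800; split=> // n k k2 kn x [a [_ xA x0 norm_x]].
exists [set u : 'I_n | odd (u %/ k.-1)]; split; first exact: independent_odd_levels.
have k0 : (0 < k.-1)%N by case: k k2 {kn x xA x0 norm_x} => [|[]].
have t2 : (2 <= n %/ k.-1)%N by rewrite leq_divRL // -subn1.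
have sum1 : \sum_u x 0 u ^+ 2 = 1.
  have sum_ge0 : 0 <= \sum_u x 0 u ^+ 2 by apply: sumr_ge0 => u _; rewrite sqr_ge0.
  by rewrite -(sqr_sqrtr sum_ge0) -/(euclidean_norm x) norm_x expr1n.
have eig u : \sum_v (Gnk k u v)%:R * x 0 v = a * x 0 u.
  (* The matrix acts on row vectors, so symmetry of [Gnk] turns its column sums into row sums. *)
  have /rowP/(_ u) := xA; rewrite !mxE => <-; apply: eq_bigr => v _.
  by rewrite mxE Gnk_sym mulrC.
apply: le_trans (Gnk_odd_norm_bound k2 t2 x0 sum1 eig) _.
rewrite ler_wpM2l // ler_wpM2r ?invr_ge0 ?exprn_ge0 //.
by rewrite lerXn2r ?nnegrE // ler_nat leq_pred.
Qed.
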